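(* Let $p\ge 1$ and let $r_1\le r_2\le\cdots\le r_p$ be nonnegative integers, $\mathbf{r}_p=(r_1,\ldots,r_p)$. For every integer $n\ge 0$, all roots of the polynomial $$B_n(z;\mathbf{r}_p)=\sum_{k=0}^{n+|\mathbf{r}_{p-1}|}{n+|\mathbf{r}_p| \brace k+r_p}_{\mathbf{r}_p} z^k$$ are real and negative.
   Context: Notation: $|\mathbf{r}_p|=r_1+\cdots+r_p$ and $|\mathbf{r}_{p-1}|=r_1+\cdots+r_{p-1}$. Let $R_1=\{1,\ldots,r_1\}$, $R_2=\{r_1+1,\ldots,r_1+r_2\}$, ..., $R_p=\{r_1+\cdots+r_{p-1}+1,\ldots,r_1+\cdots+r_p\}$. For integers $N,k$, the $(r_1,\ldots,r_p)$-Stirling number of the second kind ${N \brace k}_{\mathbf{r}_p}$ is the number of partitions of $\{1,\ldots,N\}$ into $k$ nonempty blocks such that, for each $i=1,\ldots,p$, the elements of $R_i$ lie in pairwise distinct blocks. $B_n(z;\mathbf{r}_p)$ is called the $(r_1,\ldots,r_p)$-Bell polynomial.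
   Formalization: When r_p = 0 (all r_i = 0) and n ≥ 1, z = 0 is a root, so ''negative'' fails as stated; the formal theorem proves all roots are real and nonpositive in general, and strictly negative whenever r_p > 0. *)

(* Defs.v *)
From HB Require Import structures.
From mathcomp Require Import all_boot all_order all_algebra.

Set Implicit Arguments.
Unset Strict Implicit.
Unset Printing Implicit Defensive.

Import Order.TTheory GRing.Theory Num.Theory.

Local Open Scope ring_scope.

(* The integer x + 1 of {1, ..., N} is represented by x : 'I_N, and r_(i+1)    *)
(* is [tnth r i], so that R_(i+1) is [Rset N r i].                             *)

Definition rnorm (p : nat) (r : p.-tuple nat) : nat :=
  (\sum_(i < p) tnth r i)%N.

(* r_p; meaningful for 0 < p. *)
Definition rlast (p : nat) (r : p.-tuple nat) : nat := nth 0%N r p.-1.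

(* r_1 + ... + r_(p-1). *)
Definition rnorm_pred (p : nat) (r : p.-tuple nat) : nat :=
  (\sum_(i < p | (i < p.-1)%N) tnth r i)%N.

Definition Rset (N p : nat) (r : p.-tuple nat) (i : 'I_p) : {set 'I_N} :=
  [set x : 'I_N | (\sum_(j < p | (j < i)%N) tnth r j <= x
                   < \sum_(j < p | (j <= i)%N) tnth r j)%N].

(* Meaningful when rnorm r <= N, so that each R_i is contained in {1, ..., N}:
   the elements of every R_i lie in pairwise distinct blocks. *)
Definition rstirling2 (N k p : nat) (r : p.-tuple nat) : nat :=
  #|[set P : {set {set 'I_N}} |
      [&& partition P [set: 'I_N], #|P| == k
        & [forall i : 'I_p, dinjectiveb (pblock P) (mem (Rset N r i))]]]|.

Definition rbell (A : nzRingType) (n p : nat) (r : p.-tuple nat) : {poly A} :=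
  \poly_(k < (n + rnorm_pred r).+1)
     (rstirling2 (n + rnorm r) (k + rlast r) r)%:R.

(* Main.v *)
(* Put q = r_p. Counting the functions from {1, ..., n + |r|} to a set of y + q
   elements that are injective on each R_i, first directly and then by the
   partition into fibres, gives, after division by the falling factorial
   (y + q)^_q, the identity of polynomials in y
     sum_k {n + |r|, k + q} y^_k = (y + q)^n prod_(i < p) (y + q)^_(r_i).
   The right-hand side is a product of linear factors y + a with 0 <= a <= q,
   and a > 0 when q > 0. The linear map y^_k |-> z^k turns multiplication by
   y + a into B |-> (z + a) B + z B', so the Bell polynomial is obtained from 1
   by iterating such operators. If all roots x_j of B are real and <= 0, a new
   root z != 0 satisfies 1 + a / z + sum_j 1 / (z - x_j) = 0; taking imaginary
   parts shows that z is real, and positivity of the terms excludes z > 0. *)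

Require Import Defs.
From HB Require Import structures.
From mathcomp Require Import all_boot all_order all_algebra.
From mathcomp Require Import reals.
From mathcomp Require Import complex.

Import Order.TTheory GRing.Theory Num.Theory.

(** * Counting functions that are injective on each of several disjoint sets *)

Section Updates.
Variables T Y : finType.
Implicit Types (f : {ffun T -> Y}) (A : {set T}).

Definition ffun_upd f (x : T) (y : Y) : {ffun T -> Y} :=
  [ffun t => if t == x then y else f t].

Lemma dinjectiveb_upd f A x y : x \notin A ->
  dinjectiveb (ffun_upd f x y) (mem (x |: A)) =
  dinjectiveb f (mem A) && (y \notin f @: A).
Proof.
move=> xA.
have ne t : t \in A -> (t == x) = false by apply: contraTF => /eqP ->.
apply/dinjectiveP/andP => [inj|[/dinjectiveP inj yfA]].
  split; last first.
    apply/imsetP => -[t tA yE].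
    have /eqP : t = x.
      by apply: inj; rewrite ?inE ?eqxx ?tA ?orbT// !ffunE eqxx ne.
    by rewrite ne.
  apply/dinjectiveP => t u tA uA ftu; apply: inj.
  - by rewrite !inE tA orbT.
  - by rewrite !inE uA orbT.
  - by rewrite !ffunE !ne.
move=> t u; rewrite !inE !ffunE.
have [->|tx] := eqVneq t x; have [->|ux]//= := eqVneq u x.
- by move=> _ uA yE; rewrite yE imset_f in yfA.
- by move=> tA _ yE; rewrite -yE imset_f in yfA.
- by move=> *; apply: inj.
Qed.

(** Since [P] ignores the value at [x], [swap] turns a pair of a function injective on [x |: A] and
    an arbitrary spare value into a function injective on [A] with a spare value outside the image
    of [A]. *)
Lemma card_dinjective_setU1 (P : pred {ffun T -> Y}) A x : x \notin A ->
  (forall f y, P (ffun_upd f x y) = P f) ->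
  #|[set f | P f && dinjectiveb f (mem (x |: A))]| * #|Y| =
  #|[set f | P f && dinjectiveb f (mem A)]| * (#|Y| - #|A|).
Proof.
move=> xA Pupd.
set E1 := [set f | _]; set E0 := [set f | P f && dinjectiveb f (mem A)].
(* [swap] exchanges the value of the function at x with the spare value. *)
pose swap (u : {ffun T -> Y} * Y) := (ffun_upd u.1 x u.2, u.1 x).
have swapK : involutive swap.
  case=> f y; rewrite /swap /= ffunE eqxx; congr pair.
  by apply/ffunP => t; rewrite !ffunE; case: eqP => // ->.
rewrite -[X in _ * X = _]cardsT -cardsX -(card_imset _ (inv_inj swapK)).
rewrite (can2_imset_pre _ swapK swapK) -sum1_card.
rewrite (eq_bigl (fun u => (u.1 \in E0) && (u.2 \notin u.1 @: A))); last first.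
  by case=> f y; rewrite !inE /= Pupd dinjectiveb_upd// andbT andbA.
rewrite -(pair_big_dep (mem E0) (fun f y => y \notin f @: A) (fun _ _ => 1)) /=.
rewrite -sum_nat_const; apply: eq_bigr => f.
rewrite inE => /andP[_ /dinjectiveP injf].
by rewrite sum1_card -(card_in_imset injf) -(cardC [in f @: A]) addKn.
Qed.

(** For a random function to a nonempty [Y], injectivity on [A] is independent of [P] and has
    probability [#|Y| ^_ #|A| / #|Y| ^ #|A|]; the statement clears the denominators. *)
Lemma card_dinjective_setI (P : pred {ffun T -> Y}) A :
  (forall x f y, x \in A -> P (ffun_upd f x y) = P f) ->
  #|[set f | P f && dinjectiveb f (mem A)]| * #|Y| ^ #|A| =
  #|[set f | P f]| * #|Y| ^_ #|A|.
Proof.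
elim: {A}#|A| {-2}A (erefl #|A|) => [A /eqP|m IHm A Am Pupd].
  rewrite cards_eq0 => /eqP -> _; rewrite cards0 ffactn0 expn0 !muln1.
  apply: eq_card => f; rewrite !inE; case: (P f) => //=.
  by apply/dinjectiveP => x; rewrite inE.
have [x xA] : exists x, x \in A by apply/card_gt0P; rewrite Am.
have cA : #|A :\ x| = m by move: Am; rewrite (cardsD1 x) xA => -[].
have := card_dinjective_setU1 P (A :\ x) x.
rewrite setD1K// setD11 cA => step.
rewrite Am expnS mulnA step//; last by move=> f y; apply: Pupd.
have := IHm _ cA; rewrite cA => IH.
rewrite mulnAC IH ?ffactnSr ?mulnA// => u f y; rewrite inE => /andP[_].
exact: Pupd.
Qed.

Lemma card_all_dinjective (I : eqType) (A : I -> {set T}) (s : seq I) :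
  (forall i j, i != j -> [disjoint A i & A j]) -> uniq s ->
  #|[set f : {ffun T -> Y} | all (fun i => dinjectiveb f (mem (A i))) s]|
    * \prod_(i <- s) #|Y| ^ #|A i| =
  #|Y| ^ #|T| * \prod_(i <- s) #|Y| ^_ #|A i|.
Proof.
move=> tiA; elim: s => [_|i s IHs /= /andP[i_s /IHs{}IHs]].
  rewrite !big_nil !muln1 -card_ffun -cardsT; apply: eq_card => f.
  by rewrite !inE.
rewrite !big_cons mulnA.
(* The conditions indexed by [s] take the role of [P]: by disjointness they ignore the values on
   [A i]. *)
under eq_finset => f do rewrite andbC.
rewrite card_dinjective_setI.
  by rewrite mulnAC IHs -mulnA [X in _ * X]mulnC.
move=> x f y xAi; apply: eq_in_all => j js.
have xAj : x \notin A j.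
  have ij : i != j by apply: contraNneq i_s => ->.
  by rewrite (disjointFr (tiA _ _ ij) xAi).
rewrite /dinjectiveb; congr uniq; apply/eq_in_map => t.
by rewrite mem_enum ffunE => tA; case: eqP => // tx; rewrite -tx tA in xAj.
Qed.

End Updates.

(** * Sorting functions by their partition into fibres *)

Section Kernels.
Variables T Y : finType.

Lemma eq_pblock_preim (f : T -> Y) (x y : T) :
  (pblock (preim_partition f setT) x == pblock (preim_partition f setT) y) =
  (f x == f y).
Proof.
have /and3P[/eqP covP tiP _] := preim_partitionP f setT.
rewrite eq_pblock ?covP ?inE//.
by rewrite pblock_equivalence_partition ?inE// => ? ? ? *; split=> // /eqP ->.
Qed.

Lemma preim_partition_eqP (f : T -> Y) (P : {set {set T}}) :
  partition P setT ->
  reflect (forall x y, (f x == f y) = (pblock P x == pblock P y))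
          (preim_partition f setT == P).
Proof.
move=> partP; apply: (iffP eqP) => [<- x y|fP].
  by rewrite eq_pblock_preim.
rewrite -[RHS](preim_partition_pblock partP); apply: eq_imset => x.
by apply/setP => y; rewrite !inE fP.
Qed.

(** A function with fibre partition [P] factors uniquely through [blk], as an injection from the
    blocks into [Y]. *)
Lemma card_preim_partition (P : {set {set T}}) : partition P setT ->
  #|[set f : {ffun T -> Y} | preim_partition f setT == P]| = #|Y| ^_ #|P|.
Proof.
move=> partP; have /and3P[/eqP covP tiP P0] := partP.
have Pblk x : pblock P x \in P by rewrite pblock_mem ?covP.
pose blk x : {B | B \in P} := Sub (pblock P x) (Pblk x).
have blk_onto B : exists x, B == blk x.
  have /set0Pn[x xB] : val B != set0 by apply: contraNneq P0 => <-; apply: valP.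
  by exists x; apply/eqP/val_inj; rewrite /= (def_pblock tiP (valP B) xB).
have blkE x y : (blk x == blk y) = (pblock P x == pblock P y) by [].
pose lift (g : {ffun {B | B \in P} -> Y}) : {ffun T -> Y} :=
  [ffun x => g (blk x)].
have lift_inj : injective lift.
  move=> g h /ffunP gh; apply/ffunP => B; have [x /eqP ->] := blk_onto B.
  by have := gh x; rewrite !ffunE.
have <- : #|{: {B | B \in P}}| = #|P| by rewrite card_sig.
rewrite -card_inj_ffuns -(card_imset _ lift_inj); apply: eq_card => f.
rewrite inE; apply/(preim_partition_eqP _ _ partP)/imsetP => [fP|[g]].
  (* The factor evaluates [f] at a chosen representative of each block. *)
  exists [ffun B => f (xchoose (blk_onto B))]; last first.
    apply/ffunP => x; rewrite !ffunE; apply/eqP.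
    by rewrite fP -blkE (xchooseP (blk_onto (blk x))).
  rewrite inE; apply/injectiveP => B D; rewrite !ffunE => /eqP.
  rewrite fP -blkE => /eqP.
  by rewrite -(eqP (xchooseP (blk_onto B))) -(eqP (xchooseP (blk_onto D))).
rewrite inE => /injectiveP ginj -> x y; rewrite !ffunE -blkE.
exact: inj_eq.
Qed.

(** Injectivity on a set depends only on the partition into fibres. *)
Lemma card_dinjective_partition (I : finType) (A : I -> {set T}) :
  #|[set f : {ffun T -> Y} | [forall i, dinjectiveb f (mem (A i))]]| =
  \sum_(P : {set {set T}} | partition P setT
     && [forall i, dinjectiveb (pblock P) (mem (A i))]) #|Y| ^_ #|P|.
Proof.
have dinjE (f : {ffun T -> Y}) i : dinjectiveb f (mem (A i)) =
    dinjectiveb (pblock (preim_partition f setT)) (mem (A i)).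
  apply/dinjectiveP/dinjectiveP => inj x y xA yA /eqP.
    by rewrite eq_pblock_preim => /eqP; apply: inj.
  by rewrite -eq_pblock_preim => /eqP; apply: inj.
rewrite -sum1dep_card.
rewrite (partition_big (fun f : {ffun T -> Y} => preim_partition f setT)
  (fun P => partition P setT
     && [forall i, dinjectiveb (pblock P) (mem (A i))])); last first.
  move=> f /forallP injf; rewrite preim_partitionP /=.
  by apply/forallP => i; rewrite -dinjE.
apply: eq_bigr => P /andP[partP /forallP Pinj].
rewrite -card_preim_partition// -sum1dep_card; apply: eq_bigl => f.
case: eqP => [fP|]; last by rewrite andbF.
by rewrite andbT; apply/forallP => i; rewrite dinjE fP.
Qed.

End Kernels.

Lemma leq_card_partition (T : finType) (P : {set {set T}}) (D : {set T}) :
  partition P D -> #|P| <= #|D|.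
Proof.
move=> partP; rewrite (card_partition partP) -sum1_card; apply: leq_sum => B BP.
by rewrite card_gt0; apply: contraTneq BP => ->; case/and3P: partP.
Qed.

(** * Location of roots under the operators [bell_step] *)

Local Open Scope ring_scope.
Local Open Scope complex_scope.

(** This is the logarithmic derivative, multiplied out. *)
Lemma horner_deriv_prod_XsubC (F : fieldType) (s : seq F) (z : F) :
  z \notin s ->
  (\prod_(x <- s) ('X - x%:P))^`().[z] =
  (\prod_(x <- s) ('X - x%:P)).[z] * \sum_(x <- s) (z - x)^-1.
Proof.
elim: s => [|x s IHs]; first by rewrite !big_nil derivC hornerC mulr0.
rewrite inE negb_or => /andP[zx zs].
rewrite !big_cons derivM derivXsubC mul1r hornerD !hornerM IHs// hornerXsubC.
by rewrite mulrDr [X in _ = X + _]mulrAC divff ?subr_eq0// mul1r mulrA.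
Qed.

(** The order on [C] is partial: [z <= 0] includes that [z] is real. The imaginary part of each term
    is [- 'Im z] times a nonnegative number. *)
Lemma sum_inv_sub_eqN1_le0 (C : numClosedFieldType) (s : seq C) (z : C) :
  (forall x, x \in s -> x <= 0) -> z \notin s ->
  1 + \sum_(x <- s) (z - x)^-1 = 0 -> z <= 0.
Proof.
move=> s_le0 zs eq0.
have sR x : x \in s -> x \is Num.real by move=> /s_le0; apply: ler0_real.
have zR : z \is Num.real.
  apply/Creal_ImP; move: (congr1 (fun u : C => 'Im u) eq0).
  rewrite raddfD /= raddf0 raddf_sum/= (Creal_ImP _ (rpred1 _)) add0r.
  rewrite (eq_big_seq (fun x => - 'Im z * `|z - x| ^- 2)) => [|x xs]; last first.
    by rewrite ImV raddfB/= (Creal_ImP _ (sR x xs)) subr0.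
  rewrite -mulr_sumr => /eqP; rewrite mulf_eq0 oppr_eq0 => /orP[/eqP//|].
  rewrite psumr_eq0 => [/allP s0|x _]; last by rewrite invr_ge0 exprn_ge0.
  (* All [|z - x| ^- 2] vanish: an empty [s] makes the equation 1 = 0, and otherwise [z] equals the
     head of [s]. *)
  case: s s0 zs eq0 {s_le0 sR} => [_ _|x s /(_ x (mem_head _ _))/=].
    by rewrite big_nil addr0 => /eqP; rewrite oner_eq0.
  rewrite invr_eq0 expf_eq0/= normr_eq0 subr_eq0 => /eqP ->.
  by rewrite mem_head.
rewrite real_leNgt ?real0//; apply/negP => z_gt0.
have : 0 < 1 + \sum_(x <- s) (z - x)^-1.
  rewrite ltr_wpDr ?ltr01// big_seq sumr_ge0// => x /s_le0 xle0.
  by rewrite invr_ge0 subr_ge0 (le_trans xle0)// ltW.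
by rewrite eq0 ltxx.
Qed.

(* Up to the factor z^(1-a) e^(-z), this is (z^a e^z B)'. *)
Definition bell_step (A : nzRingType) (a : nat) (B : {poly A}) : {poly A} :=
  ('X + a%:R%:P) * B + 'X * B^`().

Lemma bell_step_roots_le0 (C : numClosedFieldType) (a : nat) (B : {poly C}) :
  (forall z, root B z -> z <= 0) ->
  forall z, root (bell_step C a B) z -> z <= 0.
Proof.
move=> B_le0 z; have [/B_le0//|Bz] := boolP (root B z).
have [->//|z0] := eqVneq z 0.
have B0 : B != 0 by apply: contraNneq Bz => ->; rewrite root0.
have [s Bs] := closed_field_poly_normal B.
have rs x : (x \in s) = root B x.
  by rewrite [in RHS]Bs rootZ ?lead_coef_eq0// root_prod_XsubC.
move=> /rootP; rewrite /bell_step !(hornerE, hornerM).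
have -> : B^`().[z] = B.[z] * \sum_(x <- s) (z - x)^-1.
  by rewrite Bs derivZ !hornerZ horner_deriv_prod_XsubC ?rs// mulrA.
(* The term [a / z] is treated as coming from [a] further roots equal to 0. *)
move=> eq0; apply: (@sum_inv_sub_eqN1_le0 _ (nseq a 0 ++ s)).
- by move=> x; rewrite mem_cat mem_nseq rs => /orP[/andP[_ /eqP->]|/B_le0].
- by rewrite mem_cat mem_nseq rs (negPf z0) andbF.
have -> : \sum_(x <- nseq a 0 ++ s) (z - x)^-1
          = a%:R / z + \sum_(x <- s) (z - x)^-1.
  by rewrite big_cat big_nseq /= subr0 iter_addr_0 mulr_natl.
apply: (mulfI z0); apply: (mulfI Bz); rewrite !mulr0 -[RHS]eq0.
rewrite !mulrDr mulr1 [z * (_ / _)]mulrC divfK// mulrDl addrA.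
by rewrite [z * B.[z]]mulrC [a%:R * _]mulrC [z * (_ * _)]mulrCA.
Qed.

(** * Polynomials expanded in falling factorials *)

(* The image of B under X^k |-> y^_k; the terms with k > y vanish. *)
Definition ffact_eval (A : nzRingType) (y : nat) (B : {poly A}) : A :=
  \sum_(k < y.+1) B`_k * (y ^_ k)%:R.

(** The system is triangular: the value at [y] involves only coefficients up to index [y], the last
    one multiplied by y!, which is nonzero in characteristic 0. *)
Lemma ffact_eval_inj (A : idomainType) (B1 B2 : {poly A}) :
  [pchar A] =i pred0 ->
  (forall y, ffact_eval A y B1 = ffact_eval A y B2) -> B1 = B2.
Proof.
move=> A0 eqB; apply/polyP => y; elim/ltn_ind: y => y IHy.
have := eqB y; rewrite /ffact_eval !big_ord_recr /=.
rewrite (eq_bigr (fun i : 'I_y => B2`_i * (y ^_ i)%:R)) => [|i _]; last first.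
  by rewrite IHy.
move=> /addrI; apply: mulIf.
by rewrite ffactnn ((pcharf0P A).1 A0) -lt0n fact_gt0.
Qed.

Lemma ffact_eval_step (A : comNzRingType) (y a : nat) (B : {poly A}) :
  ffact_eval A y (bell_step A a B) = (y + a)%:R * ffact_eval A y B.
Proof.
rewrite /ffact_eval /bell_step.
under eq_bigr => k _ do
  rewrite mulrDl !coefD coefCM !coefXM coef_deriv addrAC mulrDl
       -[a%:R * _ * _]mulrA.
rewrite big_split /= -mulr_sumr natrD mulrDl; congr (_ + _).
under eq_bigr => k _ do rewrite mulrDl.
rewrite big_split /= big_ord_recl /= mul0r add0r mulr_sumr.
under eq_bigr => k _ do rewrite /bump /= add1n /=.
rewrite (eq_bigr (fun k : 'I_y => B`_k * (y ^_ k * (y - k))%:R)); last first.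
  by move=> k _; rewrite ffactnSr.
(* The index shift lost the term k = y, which is 0 through its factor y - k. *)
have -> : \sum_(k < y) B`_k * (y ^_ k * (y - k))%:R =
          \sum_(k < y.+1) B`_k * (y ^_ k * (y - k))%:R.
  by rewrite big_ord_recr /= subnn muln0 mulr0 addr0.
rewrite -big_split; apply: eq_bigr => k _ /=.
have -> : (if k == 0%N :> nat then 0 else B`_k.-1.+1 *+ k.-1.+1) = B`_k * k%:R.
  by case: k => [[|k] ?] /=; rewrite ?mulr0 ?mulr_natr.
rewrite -mulrA -mulrDr mulrCA -!natrM -natrD; congr (_ * _%:R).
by rewrite mulnC -mulnDl subnK // -ltnS.
Qed.

Lemma ffact_eval1 (A : nzRingType) (y : nat) : ffact_eval A y 1 = 1.
Proof.
rewrite /ffact_eval big_ord_recl big1 ?addr0 ?coef1 ?ffactn0 ?mulr1//= => k _.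
by rewrite coef1 mul0r.
Qed.

Definition bell_of_shifts (A : nzRingType) (s : seq nat) : {poly A} :=
  foldr (bell_step A) 1 s.

Lemma ffact_eval_bell_of_shifts (A : comNzRingType) (s : seq nat) (y : nat) :
  ffact_eval A y (bell_of_shifts A s) = (\prod_(a <- s) (y + a))%:R.
Proof.
elim: s => [|a s IHs] /=; first by rewrite big_nil ffact_eval1.
by rewrite ffact_eval_step IHs big_cons natrM.
Qed.

Lemma bell_of_shifts_roots_le0 (C : numClosedFieldType) (s : seq nat) (z : C) :
  root (bell_of_shifts C s) z -> z <= 0.
Proof.
elim: s z => [z|a s IHs]; first by rewrite /= (negPf (root1 _)).
exact: bell_step_roots_le0.
Qed.

(** At 0 each step multiplies the value by its shift, so the value there is the product of the
    shifts. *)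
Lemma bell_of_shifts_root0 (C : numDomainType) (s : seq nat) :
  root (bell_of_shifts C s) 0 = (0%N \in s).
Proof.
elim: s => [|a s IHs]; first by rewrite /= (negPf (root1 _)).
rewrite inE -IHs /root /= /bell_step !(hornerE, hornerM) mulf_eq0 pnatr_eq0.
by rewrite [0%N == _]eq_sym.
Qed.

(** * Disjointness and sizes of the sets R_i *)

Lemma card_ord_itv (N a b : nat) : (b <= N)%N ->
  #|[set x : 'I_N | (a <= x < b)%N]| = (b - a)%N.
Proof.
move=> bN; rewrite -sum1dep_card -[RHS]muln1 -sum_nat_const_nat.
rewrite (big_nat_widenl a 0)// (big_nat_widen 0 b N)// big_mkord.
by apply: eq_bigl.
Qed.

Section Rsets.
Variables (N p : nat) (r : p.-tuple nat).

Lemma sum_tnth_leq (i : 'I_p) :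
  (\sum_(j < p | (j <= i)%N) tnth r j =
   tnth r i + \sum_(j < p | (j < i)%N) tnth r j)%N.
Proof.
rewrite (bigD1 i)//=; congr addn; apply: eq_bigl => j.
by rewrite ltn_neqAle andbC -val_eqE.
Qed.

Lemma disjoint_Rset (i j : 'I_p) : i != j ->
  [disjoint Rset N r i & Rset N r j].
Proof.
wlog ij : i j / (i < j)%N.
  move=> W ne_ij; have [ij|ji|/val_inj ij] := ltngtP i j; first exact: W.
    by rewrite disjoint_sym W// eq_sym.
  by rewrite ij eqxx in ne_ij.
move=> _; rewrite disjoint_subset; apply/subsetP => x.
rewrite !inE => /andP[_ xi]; rewrite negb_and -ltnNge (leq_trans xi)//.
rewrite [leqRHS](bigID (fun k : 'I_p => (k <= i)%N)) /=.
rewrite -[leqLHS]addn0 leq_add// leq_eqVlt; apply/orP; left; apply/eqP.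
by apply: eq_bigl => k; rewrite andb_idl// => /leq_ltn_trans->.
Qed.

Lemma card_Rset (i : 'I_p) : (rnorm r <= N)%N -> #|Rset N r i| = tnth r i.
Proof.
move=> rN; rewrite card_ord_itv ?sum_tnth_leq ?addnK// -sum_tnth_leq.
rewrite (leq_trans _ rN)// /rnorm [leqRHS](bigID (fun k : 'I_p => (k <= i)%N)).
exact: leq_addr.
Qed.

End Rsets.

(** * The Bell polynomial as an iterate of [bell_step] *)

Lemma ffactnD (n m k : nat) : (n ^_ (m + k) = n ^_ m * (n - m) ^_ k)%N.
Proof.
elim: k => [|k IHk]; first by rewrite addn0 ffactn0 muln1.
by rewrite addnS !ffactnSr IHk subnDA mulnA.
Qed.

Section Bell.
Variables (p : nat) (r : p.-tuple nat).
Hypotheses (p_gt0 : (0 < p)%N) (r_sorted : sorted leq r).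

Let last_ord : 'I_p :=
  Ordinal (etrans (congr1 (leq^~ p) (prednK p_gt0)) (leqnn p)).

Lemma rlastE : rlast r = tnth r last_ord.
Proof. by rewrite (tnth_nth 0%N). Qed.

Lemma leq_rlast (i : 'I_p) : (tnth r i <= rlast r)%N.
Proof.
rewrite (tnth_nth 0%N) /rlast; apply: sorted_leq_nth => //.
- exact: leq_trans.
- by rewrite inE size_tuple.
- by rewrite inE size_tuple prednK.
- by rewrite -ltnS prednK.
Qed.

Lemma neq_last_ord (i : 'I_p) : (i != last_ord) = (i < p.-1)%N.
Proof. by rewrite -val_eqE ltn_neqAle -ltnS prednK//= ltn_ord andbT. Qed.

Lemma rnormE : rnorm r = (rnorm_pred r + rlast r)%N.
Proof.
rewrite /rnorm (bigD1 last_ord)//= -rlastE addnC; congr addn.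
by apply: eq_bigl => i; rewrite neq_last_ord.
Qed.

Lemma card_Rset_injective (n x : nat) : (rlast r <= x)%N ->
  #|[set f : {ffun 'I_(n + rnorm r) -> 'I_x} |
      [forall i, dinjectiveb f (mem (Rset (n + rnorm r) r i))]]| =
  (x ^ n * \prod_(i < p) x ^_ tnth r i)%N.
Proof.
move=> rx; have x_gt0 : (0 < x ^ rnorm r)%N.
  (* If x = 0, then r_p = 0, hence every r_i is 0 and the power is 0 ^ 0 = 1. *)
  rewrite expn_gt0; case: x rx => //=; rewrite leqn0 => /eqP r0.
  rewrite /rnorm big1// => i _; apply/eqP.
  by rewrite -leqn0 -r0 leq_rlast.
apply/eqP; rewrite -(eqn_pmul2r x_gt0); apply/eqP.
have := @card_all_dinjective _ 'I_x _ _ _ (@disjoint_Rset (n + rnorm r) p r)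
  (index_enum_uniq 'I_p).
rewrite !card_ord expnD mulnAC.
under [X in (_ * X)%N = _]eq_bigr => i _ do rewrite card_Rset ?leq_addl//.
under [X in _ = (_ * X * _)%N]eq_bigr => i _ do rewrite card_Rset ?leq_addl//.
rewrite -expn_sum => <-; congr (_ * _)%N; apply: eq_card => f; rewrite !inE.
by apply/forallP/allP => [inj i _|inj i]; apply: inj; rewrite ?mem_index_enum.
Qed.

(** Both sides are multiplied by x^_q with x = y + q: on the left x^_q * y^_k = x^_(k+q), on the
    right it supplies the missing factor for r_p. Both then count the same functions into x
    points. *)
Lemma sum_rstirling2_ffact (n y : nat) :
  (\sum_(k < y.+1 | k < (n + rnorm_pred r).+1)
     rstirling2 (n + rnorm r) (k + rlast r) r * y ^_ k =
   (y + rlast r) ^ n * \prod_(i < p | i < p.-1) (y + rlast r) ^_ tnth r i)%N.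
Proof.
set N := (n + rnorm r)%N; set q := rlast r; set x := (y + q)%N.
have xq : (0 < x ^_ q)%N by rewrite ffact_gt0 leq_addl.
apply/eqP; rewrite -(eqn_pmul2r xq) -mulnA; apply/eqP.
have -> : ((\prod_(i < p | i < p.-1) x ^_ tnth r i) * x ^_ q =
          \prod_(i < p) x ^_ tnth r i)%N.
  rewrite [RHS](bigD1 last_ord)//= -rlastE mulnC; congr muln.
  by apply: eq_bigl => i; rewrite neq_last_ord.
rewrite -card_Rset_injective ?leq_addl// card_dinjective_partition.
pose adm (P : {set {set 'I_N}}) := partition P [set: 'I_N] &&
  [forall i : 'I_p, dinjectiveb (pblock P) (mem (Rset N r i))].
rewrite big_distrl/= (eq_bigr (fun k : 'I_y.+1 =>
    \sum_(P | adm P && (#|P| == k + q)) x ^_ #|P|)%N); last first.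
  move=> k _.
  rewrite (eq_bigr (fun=> x ^_ (k + q))%N) => [|P /andP[_ /eqP->]//].
  rewrite sum_nat_cond_const -mulnA; congr muln.
    by apply: eq_card => P; rewrite !inE /adm andbAC -andbA.
  by rewrite mulnC [(k + q)%N]addnC ffactnD addnK.
rewrite (exchange_big_dep adm)/= => [|k P _ /andP[]//].
apply: eq_bigr => P /andP[partP /forallP Pinj]; rewrite card_ord.
(* The q elements of R_p lie in distinct blocks, so at most one k, namely [#|P| - q], selects
   [P]. *)
have q_leP : (q <= #|P|)%N.
  have /dinjectiveP Pinj_last := Pinj last_ord.
  rewrite -[q]/(rlast r) rlastE -(card_Rset N p r) ?leq_addl//.
  rewrite -(card_in_imset Pinj_last).
  apply/subset_leq_card/subsetP => _ /imsetP[u _ ->].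
  by rewrite pblock_mem//; case/and3P: partP => /eqP->.
have P_leN : (#|P| <= N)%N.
  by rewrite (leq_trans (leq_card_partition _ _ _ partP))// cardsT card_ord.
(* A partition with more than x blocks contributes 0 to both sides. *)
have [Px|xP] := leqP #|P| x; last first.
  by rewrite [RHS]ffact_small// big1// => k _; rewrite ffact_small.
have Py : (#|P| - q < y.+1)%N by rewrite ltnS leq_subLR addnC.
rewrite (big_pred1 (Ordinal Py))// => k.
rewrite /adm partP (introT forallP Pinj) /= -val_eqE /= -[RHS](eqn_add2r q).
(* The degree bound on k follows from [#|P| <= N] and |r| = |r_(p-1)| + q. *)
rewrite subnK// [RHS]eq_sym andb_idl// => /eqP Pk.
by rewrite ltnS -(leq_add2r q) -Pk -addnA -rnormE.
Qed.

(** These are the shifts in (y + q)^n and in (y + q)^_(r_i) = prod_(j < r_i) (y + (q - j)) for i <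
    p; the subtraction never truncates, as j < r_i <= q. *)
Definition bell_shifts (n : nat) : seq nat :=
  nseq n (rlast r) ++
  [seq (rlast r - j)%N | i <- [seq i : 'I_p <- index_enum 'I_p | (i < p.-1)%N],
                         j <- iota 0 (tnth r i)].

Lemma prod_bell_shifts (n y : nat) :
  (\prod_(a <- bell_shifts n) (y + a) =
   (y + rlast r) ^ n * \prod_(i < p | i < p.-1) (y + rlast r) ^_ tnth r i)%N.
Proof.
rewrite big_cat big_nseq iter_muln_1 big_allpairs_dep big_filter/=; congr muln.
apply: eq_bigr => i _; rewrite ffact_prod -(big_mkord xpredT (fun j => _ - j)%N).
rewrite /index_iota subn0; apply: eq_big_seq => j; rewrite mem_iota => /andP[_ ji].
by rewrite addnBA// (leq_trans (ltnW ji)) ?leq_rlast.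
Qed.

Lemma bell_shifts_gt0 (n : nat) : (0 < rlast r)%N -> 0%N \notin bell_shifts n.
Proof.
move=> r_gt0; rewrite mem_cat negb_or mem_nseq ltn_eqF// andbF/=.
apply/negP => /allpairsPdep[i [j [_]]]; rewrite mem_iota add0n /= => ji /esym/eqP.
by rewrite subn_eq0 leqNgt (leq_trans ji) ?leq_rlast.
Qed.

(** Both polynomials have the same falling factorial evaluation at every natural number. *)
Lemma rbellE (C : numDomainType) (n : nat) :
  rbell C n r = bell_of_shifts C (bell_shifts n).
Proof.
apply: ffact_eval_inj => [|y]; first exact: pchar_num.
rewrite ffact_eval_bell_of_shifts prod_bell_shifts -sum_rstirling2_ffact.
rewrite natr_sum [RHS]big_mkcond; apply: eq_bigr => k _.
by rewrite coef_poly; case: ifP; rewrite ?mul0r// natrM.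
Qed.

End Bell.

(** Strict negativity is asserted for r_p > 0: if r_p = 0, the shifts are n zeros, and 0 is a root
    as soon as n > 0. *)
Theorem theorem1 (R : realType) (p : nat) (hp : (0 < p)%N)
    (r : p.-tuple nat) (hr : sorted leq r) (n : nat) (z : R[i]) :
  root (rbell R[i] n r) z ->
  exists x : R, [/\ z = x%:C, x <= 0 & (0 < rlast r)%N -> x < 0].
Proof.
rewrite rbellE// => Bz; have := bell_of_shifts_roots_le0 _ _ _ Bz.
case: z Bz => x y Bz; rewrite lecE /= => /andP[/eqP y0 x_le0].
exists x; split=> // [|r_gt0]; first by rewrite -y0.
rewrite lt_neqAle x_le0 andbT; apply: contraTneq Bz => ->.
by rewrite -y0 bell_of_shifts_root0 bell_shifts_gt0.
Qed.
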